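(* Let $f:\{0,1\}^2\to\{0,1\}$ be a boolean function on two variables and let $\mathcal{X}$ be the class of equivalence graphs. Then $f(\mathcal{X})$ is a class of perfect graphs.
   Context: All graphs are finite and simple. An equivalence graph is a graph each of whose connected components is complete. For a graph $G$ and distinct vertices $u,w$, $G(u,w)=1$ if they are adjacent and $0$ otherwise. For a boolean function $f:\{0,1\}^2\to\{0,1\}$ and a class $\mathcal{X}$, $f(\mathcal{X})$ is the class of all graphs $G$ on a vertex set $V$ for which there exist $H_1,H_2\in\mathcal{X}$ on vertex set $V$ with $G(a,b)=f(H_1(a,b),H_2(a,b))$ for all distinct $a,b\in V$. A graph is perfect if every induced subgraph has chromatic number equal to its clique number. *)

(* Defs.v *)
From mathcomp Require Import all_boot.
Set Implicit Arguments.
Unset Strict Implicit.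
Unset Printing Implicit Defensive.

Record sgraph (V : finType) := SGraph {
  adj :> rel V;
  adj_sym : symmetric adj;
  adj_irrefl : irreflexive adj
}.

Definition graph_class := forall V : finType, sgraph V -> Prop.

Definition induced_rel (V : finType) (G : sgraph V) (S : {set V}) :
    rel {x : V | x \in S} :=
  fun x y => G (val x) (val y).

Lemma induced_sym (V : finType) (G : sgraph V) (S : {set V}) :
  symmetric (@induced_rel V G S).
Proof. by move=> x y; apply: adj_sym. Qed.

Lemma induced_irrefl (V : finType) (G : sgraph V) (S : {set V}) :
  irreflexive (@induced_rel V G S).
Proof. by move=> x; apply: adj_irrefl. Qed.

Definition induced (V : finType) (G : sgraph V) (S : {set V}) :
    sgraph {x : V | x \in S} :=
  SGraph (@induced_sym V G S) (@induced_irrefl V G S).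

Definition clique (V : finType) (G : sgraph V) (S : {set V}) : bool :=
  [forall x in S, forall y in S, (x != y) ==> G x y].

Definition clique_number (V : finType) (G : sgraph V) : nat :=
  \max_(S : {set V} | clique G S) #|S|.

Definition colorable (V : finType) (G : sgraph V) (k : nat) : bool :=
  [exists c : {ffun V -> 'I_k}, forall x, forall y, G x y ==> (c x != c y)].

Lemma ex_colorable (V : finType) (G : sgraph V) : exists k, colorable G k.
Proof.
exists #|V|; apply/existsP; exists [ffun x => enum_rank x].
apply/forallP => x; apply/forallP => y; apply/implyP => Gxy; rewrite !ffunE.
apply/eqP => /enum_rank_inj xy.
by move: Gxy; rewrite xy adj_irrefl.
Qed.

Definition chromatic_number (V : finType) (G : sgraph V) : nat :=
  ex_minn (ex_colorable G).

Definition component (V : finType) (G : sgraph V) (x : V) : {set V} :=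
  [set y | connect G x y].

Definition equivalence_graph : graph_class :=
  fun V G => forall x : V, clique G (component G x).

Definition perfect : graph_class :=
  fun V G => forall S : {set V},
    chromatic_number (induced G S) = clique_number (induced G S).

Definition bool_class (f : bool -> bool -> bool) (X : graph_class) :
    graph_class :=
  fun V G => exists H1 H2 : sgraph V,
    [/\ X V H1, X V H2 &
        forall a b : V, a != b -> G a b = f (H1 a b) (H2 a b)].

(* Main.v *)
(** An equivalence graph is the relation [row x = row y] for some labelling
    [row], so a graph in [f(X)] is given by two labellings [row] and [col],
    i.e. by regarding vertices as edges of a bipartite multigraph.  Replacing a
    labelling by an injective one or by the pair [(row, col)] reduces the
    sixteen functions [f] to or, xor, nor and xnor.  For or and xor, the
    equality of chromatic and clique number is König's edge-colouring theorem;
    for nor and xnor it is the König-Egerváry theorem, unweighted and weighted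
    by the sizes of the cells of vertices with equal labels.  Both theorems
    come from exchanging two matchings along one alternating path. *)
Require Import Defs.
From mathcomp Require Import all_boot.

Set Implicit Arguments.
Unset Strict Implicit.
Unset Printing Implicit Defensive.

(** * Matchings and alternating paths in a bipartite multigraph *)

Section Matchings.

Variables (V : finType) (R C : eqType) (row : V -> R) (col : V -> C).
Implicit Types (A S M N K : {set V}) (w : V -> nat).

(** Elements of [V] act as edges with ends [row x] and [col x]; distinct elements with both labels
    equal are parallel edges. *)
Definition matching M :=
  {in M &, forall x y, row x = row y \/ col x = col y -> x = y}.

(** The direction matters: a walk leaves an [N]-edge through its column and an [M]-edge through its
    row. *)
Definition alternating_step M N : rel V := fun x y =>
  [&& x \in N, y \in M & col x == col y] || [&& x \in M, y \in N & row x == row y].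

Lemma connect_last (e : rel V) x y :
  connect e x y -> x = y \/ exists2 z, connect e x z & e z y.
Proof.
case/connectP=> p; case/lastP: p => [_ ->|p z]; first by left.
rewrite rcons_path last_rcons => /andP[ep ez] ->; right.
by exists (last x p) => //; apply/connectP; exists p.
Qed.

(* The path leaves [row e] along [N] and enters columns only along [N], so it
   never reaches [col e]; hence the swap frees [row e] in [N] and keeps
   [col e] free. *)
Lemma matching_exchange M N e :
  matching M -> matching N ->
  {in M, forall x, row x <> row e} -> {in N, forall x, col x <> col e} ->
  exists M' N',
    [/\ matching M', matching N', M' :|: N' = M :|: N, M' :&: N' = M :&: N
      & {in N', forall x, row x <> row e /\ col x <> col e}].
Proof.
move=> mM mN Me Ne.
have [x0 /andP[x0N /eqP x0e]|noN] := pickP [pred x in N | row x == row e];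
  last first.
  exists M, N; split=> // x xN; split; last exact: Ne.
  by move=> xe; have /= := noN x; rewrite xN xe eqxx.
pose K := [set x | connect (alternating_step M N) x0 x].
have Kcol x y : x \in K -> x \in N -> y \in M -> col x = col y -> y \in K.
  rewrite !inE => Kx xN yM xy; apply: connect_trans Kx (connect1 _).
  by rewrite /alternating_step xN yM xy eqxx.
have Krow x y : x \in K -> x \in M -> y \in N -> row x = row y -> y \in K.
  rewrite !inE => Kx xM yN xy; apply: connect_trans Kx (connect1 _).
  by rewrite /alternating_step xM yN xy eqxx orbT.
have x0K : x0 \in K by rewrite inE connect0.
have Kpred x : x \in K ->
    (x \in N /\ (x = x0 \/ exists z, [/\ z \in K, z \in M & row z = row x])) \/
    (x \in M /\ exists z, [/\ z \in K, z \in N & col z = col x]).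
  rewrite inE => /connect_last[<-|[z x0z]]; first by left; split=> //; left.
  case/orP=> /and3P[zX xY /eqP zx]; [right|left]; split=> //.
    by exists z; rewrite inE.
  by right; exists z; rewrite inE.
(* The swapped parts must not collide with the unswapped ones. A common column would extend the path
   to [x]. At a common row, either [y] is [x0], whose row [M] misses, or the path entered [y] from
   an [M]-edge at that row, which must be [x]. *)
have crossM x y : x \in M -> x \notin K -> y \in N -> y \in K ->
    row x = row y \/ col x = col y -> x = y.
  move=> xM xK yN yK [] xy; last by rewrite (Kcol y) in xK.
  case: (Kpred y yK) => [[_ [y0|[z [zK zM zy]]]]|[yM _]].
  - by case: (Me x xM); rewrite xy y0.
  - by rewrite -(mM z x zM xM) ?zK // in xK; left; rewrite zy xy.
  - by apply: mM => //; left.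
have crossN x y : x \in N -> x \notin K -> y \in M -> y \in K ->
    row x = row y \/ col x = col y -> x = y.
  move=> xN xK yM yK [] xy; first by rewrite (Krow y) in xK.
  case: (Kpred y yK) => [[yN _]|[_ [z [zK zN zy]]]].
    by apply: mN => //; right.
  by rewrite -(mN z x zN xN) ?zK // in xK; right; rewrite zy xy.
have flip x y : row x = row y \/ col x = col y ->
    row y = row x \/ col y = col x by case; [left|right].
exists (M :\: K :|: N :&: K), (N :\: K :|: M :&: K); split.
- move=> x y; rewrite !(in_setU, in_setD, in_setI).
  case/orP=> /andP[X1 X2] /orP[] /andP[Y1 Y2] xy.
  + exact: mM.
  + exact: crossM.
  + by apply/esym/crossM => //; apply: flip.
  + exact: mN.
- move=> x y; rewrite !(in_setU, in_setD, in_setI).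
  case/orP=> /andP[X1 X2] /orP[] /andP[Y1 Y2] xy.
  + exact: mN.
  + exact: crossN.
  + by apply/esym/crossN => //; apply: flip.
  + exact: mM.
- by apply/setP=> x; rewrite !inE; do 3!case: (_ x) => //=; do ?case: (x \in _).
- by apply/setP=> x; rewrite !inE; do 3!case: (_ x) => //=; do ?case: (x \in _).
- move=> x; rewrite !(in_setU, in_setD, in_setI) => /orP[/andP[xK xN]|/andP[xM xK]]; split.
  + by move=> xe; rewrite -(mN x0 x x0N xN) ?x0K // in xK; left; rewrite x0e.
  + exact: Ne.
  + exact: Me.
  + case: (Kpred x xK) => [[xN _]|[_ [z [_ zN zx]]]]; first exact: Ne.
    by rewrite -zx; apply: Ne.
Qed.

Lemma sum_setUI (A B : {set V}) w :
  \sum_(x in A :|: B) w x + \sum_(x in A :&: B) w x =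
  \sum_(x in A) w x + \sum_(x in B) w x.
Proof.
rewrite (big_setID B) /= setIUl setIid setDUl setDv setU0.
rewrite [in RHS](big_setID B) /= (setUidPr (subsetIr A B)).
by rewrite addnC [X in _ + X = _]addnC addnA.
Qed.

(* If one maximum matching missed [row e] and another missed [col e], an
   exchange would produce a maximum matching to which [e] can be added. *)
Lemma max_matchings_meet A w n e :
  e \in A -> 0 < w e ->
  (forall M, M \subset A -> matching M -> \sum_(x in M) w x <= n) ->
  (forall M, M \subset A -> matching M -> \sum_(x in M) w x = n ->
     exists2 x, x \in M & row x = row e) \/
  (forall M, M \subset A -> matching M -> \sum_(x in M) w x = n ->
     exists2 x, x \in M & col x = col e).
Proof.
move=> eA we bound.
(* The boolean form allows a case split on whether some matching of weight [n] misses [row e]. *)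
pose matchb M := [forall x in M, forall y in M,
  ((row x == row y) || (col x == col y)) ==> (x == y)].
have matchP M : reflect (matching M) (matchb M).
  apply: (iffP forall_inP) => [mM x y xM yM xy|mM x xM].
    have /forall_inP/(_ y yM)/implyP := mM x xM => h; apply/eqP/h.
    by case: xy => ->; rewrite eqxx ?orbT.
  apply/forall_inP => y yM; apply/implyP => xy; apply/eqP/mM => //.
  by case/orP: xy => /eqP; [left|right].
pose maxb M := [&& M \subset A, matchb M & \sum_(x in M) w x == n].
have [M /andP[/and3P[MA /matchP mM /eqP wM] Me]|noM] :=
  pickP [pred M | maxb M && [forall x in M, row x != row e]]; last first.
  left=> M MA /matchP mM wM; have /= := noM M.
  rewrite /maxb MA mM wM eqxx /= => /negbT/forall_inPn[x xM].
  by rewrite negbK => /eqP xe; exists x.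
right=> N NA mN wN.
have [x /andP[xN /eqP xe]|noN] := pickP [pred x in N | col x == col e].
  by exists x.
have Me' : {in M, forall x, row x <> row e}.
  by move=> x xM; apply/eqP; move/forall_inP: Me; apply.
have Ne' : {in N, forall x, col x <> col e}.
  by move=> x xN xe; have /= := noN x; rewrite xN xe eqxx.
have [M' [N' [mM' mN' U I free]]] := matching_exchange mM mN Me' Ne'.
have UA : M' :|: N' \subset A by rewrite U subUset MA NA.
have [M'A N'A] : M' \subset A /\ N' \subset A by apply/andP; rewrite -subUset.
have eN' : e \notin N' by apply/negP => /free[].
(* The exchange keeps union and intersection, so the weights of [M'] and [N'] still add up to
   [n + n]. Adding [e], of positive weight, to [N'] then violates [bound]. *)
have := sum_setUI M' N' w; rewrite U I sum_setUI wM wN => sum_eq.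
have meN' : matching (e |: N').
  move=> x y /setU1P[->|xN] /setU1P[->|yN] // xy; last exact: mN'.
    by case: (free y yN) xy => ? ? [] /esym.
  by case: (free x xN) xy => ? ? [].
have := bound _ _ meN'; rewrite subUset sub1set eA => /(_ N'A).
rewrite big_setU1 //= => lt_n.
have := leq_add (bound _ M'A mM') lt_n.
by rewrite addnCA -sum_eq -{2}(add0n (n + n)) leq_add2r leqNgt we.
Qed.

(** * Edge colouring of bipartite multigraphs *)

Lemma missing_color (B : {set V}) (c : V -> nat) k :
  #|B| < k -> exists2 a, a < k & {in B, forall x, c x <> a}.
Proof.
move=> Bk; have [a aP|all_hit] := pickP [pred a : 'I_k | [forall x in B, c x != a]].
  by exists a => // x xB; apply/eqP; move/forall_inP: aP; apply.
have [f fB fc] : exists2 f : 'I_k -> V, forall a, f a \in B & forall a, c (f a) = a.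
  have hit (a : 'I_k) : exists x, (x \in B) && (c x == a).
    have /negbT/forall_inPn[x xB] := all_hit a.
    by rewrite negbK => cx; exists x; rewrite xB.
  exists (fun a => xchoose (hit a)) => a.
    by case/andP: (xchooseP (hit a)).
  by case/andP: (xchooseP (hit a)) => _ /eqP.
have f_inj : injective f by move=> a b fab; apply/val_inj; rewrite /= -!fc fab.
have: #|f @: [set: 'I_k]| <= #|B|.
  by apply/subset_leq_card/subsetP => _ /imsetP[a _ ->].
by rewrite card_imset // cardsT card_ord leqNgt Bk.
Qed.

(** Induction on the number of edges: after colouring all but [e], some colour [a] is missing at
    [row e] and some [b] at [col e]. Exchanging these two colour classes frees [b] at both ends, and
    [e] receives [b]. *)
Lemma bipartite_edge_coloring A k :
  (forall e, #|[set x in A | row x == row e]| <= k) ->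
  (forall e, #|[set x in A | col x == col e]| <= k) ->
  exists c : V -> nat, {in A, forall x, c x < k} /\
    {in A &, forall x y, row x = row y \/ col x = col y -> c x = c y -> x = y}.
Proof.
move: {2}#|A| (erefl #|A|) => n; elim: n A => [|n IHn] A An Arow Acol.
  have -> : A = set0 by apply/cards0_eq.
  by exists (fun=> 0); split=> [x|x y]; rewrite inE.
have /card_gt0P[e eA] : 0 < #|A| by rewrite An.
pose B := A :\ e.
have BA : B \subset A by apply: subsetDl.
have Bn : #|B| = n by move: An; rewrite (cardsD1 e) eA => -[].
have lt_deg (P : pred V) : P e -> #|[set x in B | P x]| < #|[set x in A | P x]|.
  move=> Pe; apply/proper_card/properP; split.
    by apply/subsetP => x; rewrite !inE => /andP[/andP[_ ->] ->].
  by exists e; rewrite !inE ?eqxx ?eA.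
have le_deg (P : pred V) : #|[set x in B | P x]| <= #|[set x in A | P x]|.
  apply/subset_leq_card/subsetP => x; rewrite !inE.
  by case/andP=> [/andP[_ ->] ->].
have [c [ck c_proper]] := IHn B Bn (fun u => leq_trans (le_deg _) (Arow u))
                                   (fun u => leq_trans (le_deg _) (Acol u)).
have [a ak ca] : exists2 a, a < k & {in [set x in B | row x == row e], forall x, c x <> a}.
  by apply/missing_color/(leq_trans _ (Arow e))/(lt_deg (fun x => row x == row e)).
have [b bk cb] : exists2 b, b < k & {in [set x in B | col x == col e], forall x, c x <> b}.
  by apply/missing_color/(leq_trans _ (Acol e))/(lt_deg (fun x => col x == col e)).
pose cl i := [set x in B | c x == i].
have m_cl i : matching (cl i).
  move=> x y; rewrite !inE -!in_setD1 => /andP[xB /eqP cx] /andP[yB /eqP cy] xy.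
  by apply: c_proper => //; rewrite cx.
have [|x|M [N [mM mN U I free]]] := @matching_exchange (cl a) (cl b) e (m_cl a) (m_cl b).
- move=> x; rewrite !inE -in_setD1 => /andP[xB /eqP cx] xe.
  by apply: (ca x) => //; rewrite inE xB xe /=.
- rewrite !inE -in_setD1 => /andP[xB /eqP cx] xe.
  by apply: (cb x) => //; rewrite inE xB xe /=.
have eN : e \notin N by apply/negP => /free[].
have U_ab x : x \in B -> (x \in M) || (x \in N) = (c x == a) || (c x == b).
  by move=> xB; rewrite -in_setU U !inE -!in_setD1 xB.
have U_B x : (x \in M) || (x \in N) -> x \in B.
  by rewrite -in_setU U !inE -!in_setD1; case/orP=> /andP[].
(* The missing colours may coincide; preservation of union and intersection then forces [M] and [N]
   to be the same class. *)
have MN x : a = b -> x \in M -> x \in N.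
  move=> ab xM; have : x \in M :|: N by rewrite inE xM.
  by rewrite U ab setUid -(setIid (cl b)) -{1}ab -I => /setIP[].
have meN : matching (e |: N).
  move=> x y /setU1P[->|xN] /setU1P[->|yN] // xy; last exact: mN.
    by case: (free y yN) xy => ? ? [] /esym.
  by case: (free x xN) xy => ? ? [].
pose c' x := if x \in e |: N then b else if x \in M then a else c x.
exists c'; split=> [x xA|x y xA yA xy].
  rewrite /c'; case: ifP => // /negbT; rewrite in_setU1 negb_or => /andP[xe _].
  by case: ifP => // _; apply: ck; rewrite in_setD1 xe.
have c'_cases x' : x' \in A ->
  [\/ x' \in e |: N /\ c' x' = b, [/\ x' \in M, x' \notin N & c' x' = a]
    | [/\ x' \in B, c' x' = c x', c x' != a & c x' != b]].
  move=> x'A; rewrite /c'; case: ifPn => [|nx]; first by constructor 1.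
  have /norP[x'e x'N] : ~~ ((x' == e) || (x' \in N)) by rewrite -in_setU1.
  case: ifPn => x'M; first by constructor 2.
  have x'B : x' \in B by rewrite in_setD1 x'e.
  constructor 3; split=> //; move: (U_ab _ x'B);
    by rewrite (negPf x'M) (negPf x'N) /= => /esym/negbT/norP[].
case: (c'_cases x xA) => [[xN ->]|[xM nxN ->]|[xB -> cxa cxb]];
case: (c'_cases y yA) => [[yN ->]|[yM nyN ->]|[yB -> cya cyb]] E.
- exact: meN.
- by rewrite (MN y (esym E) yM) in nyN.
- by rewrite E eqxx in cyb.
- by rewrite (MN x E xM) in nxN.
- exact: mM.
- by rewrite E eqxx in cya.
- by rewrite E eqxx in cxb.
- by rewrite E eqxx in cxa.
- exact: c_proper.
Qed.

(** * Representatives of cells of parallel edges *)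

Definition cell_rep S x :=
  odflt x [pick y in S | (row y == row x) && (col y == col x)].

Lemma cell_repP S x : x \in S ->
  [/\ cell_rep S x \in S, row (cell_rep S x) = row x & col (cell_rep S x) = col x].
Proof.
move=> xS; rewrite /cell_rep; case: pickP => [y /and3P[yS /eqP ? /eqP ?] //|].
by move/(_ x); rewrite xS !eqxx.
Qed.

(** The predicate given to [pick] depends on a vertex only through its labels; [x \in S] rules out
    the default value, which depends on the vertex itself. *)
Lemma eq_cell_rep S x y : x \in S ->
  row x = row y -> col x = col y -> cell_rep S x = cell_rep S y.
Proof.
move=> xS rxy cxy; rewrite /cell_rep rxy cxy; case: pickP => // /(_ x).
by rewrite xS rxy cxy !eqxx.
Qed.

Lemma cell_rep_inj S x y : x \in S -> y \in S ->
  row (cell_rep S x) = row (cell_rep S y) ->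
  col (cell_rep S x) = col (cell_rep S y) -> cell_rep S x = cell_rep S y.
Proof.
move=> xS yS; have [_ -> ->] := cell_repP xS; have [_ -> ->] := cell_repP yS.
exact: eq_cell_rep.
Qed.

End Matchings.

(** * Cliques, stable sets and colourings *)

Section Colorings.

Variables (V : finType) (G : sgraph V).
Implicit Types (S K M I : {set V}).

Lemma cliqueP S :
  reflect {in S &, forall x y, x != y -> G x y} (clique G S).
Proof.
apply: (iffP forall_inP) => [cS x y xS yS|cS x xS].
  by move/forall_inP: (cS x xS) => /(_ y yS)/implyP.
by apply/forall_inP => y yS; apply/implyP; apply: cS.
Qed.

Lemma leq_clique_number K : clique G K -> #|K| <= clique_number G.
Proof. by move=> cK; apply: (leq_bigmax_cond (F := fun S : {set V} => #|S|)). Qed.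

Lemma coloring_colorable k (c : V -> nat) :
  (forall x, c x < k) -> (forall x y, G x y -> c x <> c y) -> colorable G k.
Proof.
move=> ck c_proper; apply/existsP; exists [ffun x => Ordinal (ck x)].
apply/forallP => x; apply/forallP => y; apply/implyP => Gxy; rewrite !ffunE.
by apply/eqP => -[]; apply: c_proper.
Qed.

Lemma clique_leq_colorable k K : colorable G k -> clique G K -> #|K| <= k.
Proof.
case/existsP=> c /forallP c_proper /cliqueP cK.
have c_inj : {in K &, injective c}.
  move=> x y xK yK cxy; apply/eqP; apply: contraT => /(cK x y xK yK) Gxy.
  by have /forallP/(_ y)/implyP/(_ Gxy) := c_proper x; rewrite cxy eqxx.
by rewrite -(card_in_imset c_inj) -[X in _ <= X](card_ord k) max_card.
Qed.

(** The other inequality holds in every graph, since a proper colouring is injective on a clique. *)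
Lemma chromatic_eq_clique_number :
  colorable G (clique_number G) -> chromatic_number G = clique_number G.
Proof.
move=> colG; rewrite /chromatic_number; case: ex_minnP => k colk min_k.
apply/eqP; rewrite eqn_leq min_k //; apply/bigmax_leqP => K.
exact: clique_leq_colorable.
Qed.

Definition stable I := {in I &, forall x y, ~~ G x y}.

(* Greedy colouring: each stable set meeting all maximum cliques of the
   remaining vertices is one colour class. *)
Lemma colorable_of_stable_transversals :
  (forall S n e, e \in S ->
     (forall K, K \subset S -> clique G K -> #|K| <= n) ->
     exists2 I, stable I &
       forall K, K \subset S -> clique G K -> #|K| = n ->
       exists2 x, x \in K & x \in I) ->
  colorable G (clique_number G).
Proof.
move=> transversal.
suff [c [ck c_proper]] : exists c : V -> nat,
    {in [set: V], forall x, c x < clique_number G} /\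
    {in [set: V] &, forall x y, G x y -> c x <> c y}.
  by apply: (@coloring_colorable _ c) => [x|x y]; [apply: ck|apply: c_proper].
have: forall K, K \subset [set: V] -> clique G K -> #|K| <= clique_number G.
  by move=> K _; apply: leq_clique_number.
(* The induction is on the bound [n] for clique sizes inside a varying [S]: removing one transversal
   lowers it by one, and for bound 0 singleton cliques force [S] to be empty. *)
move: [set: V] (clique_number G) => S n; elim: n S => [|n IHn] S bound.
  have S0 x : x \notin S.
    apply/negP => xS; suff /bound : [set x] \subset S.
      rewrite cards1 => bound_x; suff /bound_x : clique G [set x] by [].
      by apply/cliqueP => y z; rewrite !inE => /eqP-> /eqP->; rewrite eqxx.
    by rewrite sub1set.
  by exists (fun=> 0); split=> [x|x y]; rewrite (negPf (S0 x)).
have [S0|[e eS]] := set_0Vmem S.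
  by exists (fun=> 0); split=> [x|x y]; rewrite S0 inE.
have [I stI hitI] := transversal S n.+1 e eS bound.
have [K KS cK|c [cn c_proper]] := IHn (S :\: I).
  have KS' := subset_trans KS (subsetDl S I).
  have := bound K KS' cK; rewrite leq_eqVlt ltnS => /orP[/eqP Kn|//].
  have [x xK xI] := hitI K KS' cK Kn.
  by have := subsetP KS x xK; rewrite inE xI.
exists (fun x => if x \in I then n else c x); split=> [x xS|x y xS yS Gxy].
  by case: ifPn => // xI; apply/ltnW/cn; rewrite inE xI.
case: ifPn => xI; case: ifPn => yI.
- by have := stI x y xI yI; rewrite Gxy.
- by have := cn y; rewrite inE yI yS => /(_ isT) lt_c E; rewrite -E ltnn in lt_c.
- by have := cn x; rewrite inE xI xS => /(_ isT) lt_c E; rewrite E ltnn in lt_c.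
- by apply: c_proper => //; rewrite inE ?xI ?yI.
Qed.

(** The diagonal is excluded because [G] is irreflexive while [f true true] may hold. *)
Definition represents (R C : eqType) (row : V -> R) (col : V -> C)
    (f : bool -> bool -> bool) :=
  forall x y, x != y -> G x y = f (row x == row y) (col x == col y).

(** * The four basic cases: or, xor, nor and xnor *)

Variables (R C : eqType) (row : V -> R) (col : V -> C).

Lemma adj_neq x y : G x y -> x != y.
Proof. by apply: contraTneq => ->; rewrite adj_irrefl. Qed.

(** Here [G] is a line graph: the edges at one end form a clique, so all degrees are at most the
    clique number, and a proper edge colouring colours [G]. *)
Lemma colorable_or : represents row col orb -> colorable G (clique_number G).
Proof.
move=> repG.
have [||c [ck c_proper]] := @bipartite_edge_coloring _ _ _ row col
    [set: V] (clique_number G).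
- move=> e; apply/leq_clique_number/cliqueP => x y.
  by rewrite !inE => /eqP xe /eqP ye xy; rewrite repG // xe ye eqxx.
- move=> e; apply/leq_clique_number/cliqueP => x y.
  by rewrite !inE => /eqP xe /eqP ye xy; rewrite repG // xe ye eqxx orbT.
apply: (@coloring_colorable _ c) => [x|x y Gxy cxy]; first exact: ck.
have xy := adj_neq Gxy; move: Gxy; rewrite repG // => sh.
case/eqP: xy; apply: c_proper => //.
by case/orP: sh => /eqP; [left|right].
Qed.

(** Vertices of one cell are non-adjacent and can share a colour, so only representatives are
    edge-coloured. Distinct representatives sharing one label differ in the other, hence are
    adjacent, which bounds the degrees. *)
Lemma colorable_xor : represents row col addb -> colorable G (clique_number G).
Proof.
move=> repG; pose rep := cell_rep row col [set: V].
have repP x : row (rep x) = row x /\ col (rep x) = col x.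
  by have [] := @cell_repP _ _ _ row col [set: V] x (in_setT x).
have rep_inj x y : row (rep x) = row (rep y) -> col (rep x) = col (rep y) ->
  rep x = rep y by apply: cell_rep_inj; rewrite inE.
have [||c [ck c_proper]] := @bipartite_edge_coloring _ _ _ row col
    (rep @: [set: V]) (clique_number G).
- move=> e; apply/leq_clique_number/cliqueP => x y; rewrite !inE.
  case/andP=> /imsetP[u _ ->] /eqP ue /andP[/imsetP[v _ ->] /eqP ve] uv.
  rewrite repG // ue ve eqxx /=; apply: contraNN uv => /eqP uv.
  by apply/eqP/rep_inj; rewrite ?ue ?ve.
- move=> e; apply/leq_clique_number/cliqueP => x y; rewrite !inE.
  case/andP=> /imsetP[u _ ->] /eqP ue /andP[/imsetP[v _ ->] /eqP ve] uv.
  rewrite repG // ue ve eqxx /= addbT; apply: contraNN uv => /eqP uv.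
  by apply/eqP/rep_inj; rewrite ?ue ?ve.
have repT x : rep x \in rep @: [set: V] by apply: imset_f; rewrite inE.
apply: (@coloring_colorable _ (fun x => c (rep x))) => [x|x y Gxy cxy].
  exact: ck.
move: (Gxy); rewrite repG ?adj_neq //.
have [rx cx] := repP x; have [ry cy] := repP y.
have [rxy|nrxy] := eqVneq (row x) (row y);
  have [cxy'|ncxy] := eqVneq (col x) (col y) => //= _.
- have E : rep x = rep y by apply: c_proper => //; left; rewrite rx ry.
  by case/eqP: ncxy; rewrite -cx -cy E.
- have E : rep x = rep y by apply: c_proper => //; right; rewrite cx cy.
  by case/eqP: nrxy; rewrite -rx -ry E.
Qed.

(** Cliques are exactly matchings and each label class is stable, so unit weights in
    [max_matchings_meet] make the row or the column of [e] a transversal. *)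
Lemma colorable_nor :
  represents row col (fun a b => ~~ (a || b)) -> colorable G (clique_number G).
Proof.
move=> repG; apply: colorable_of_stable_transversals => S n e eS bound.
have clique_matching K : clique G K <-> matching row col K.
  split=> [/cliqueP cK x y xK yK xy|mK].
    apply/eqP; apply: contraT => nxy; have := cK x y xK yK nxy.
    by rewrite repG //; case: xy => ->; rewrite eqxx ?orbT.
  apply/cliqueP => x y xK yK nxy; rewrite repG //; apply: contraNN nxy => xy.
  by apply/eqP/mK => //; case/orP: xy => /eqP; [left|right].
have st (T : eqType) (h : V -> T) : (forall x y, G x y -> h x != h y) ->
    stable [set x | h x == h e].
  move=> hG x y; rewrite !inE => /eqP xe /eqP ye; apply/negP => /hG.
  by rewrite xe ye eqxx.
have [M MS mM|hit|hit] :=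
  @max_matchings_meet _ _ _ row col S (fun=> 1) n e eS isT.
- by rewrite sum1_card bound //; apply/clique_matching.
- exists [set x | row x == row e].
    apply: st => x y Gxy; move: (Gxy); rewrite repG ?adj_neq //.
    by case/norP.
  move=> K KS cK Kn; have [||x xK xe] := hit K KS; first exact/clique_matching.
    by rewrite sum1_card.
  by exists x => //; rewrite inE xe.
- exists [set x | col x == col e].
    apply: st => x y Gxy; move: (Gxy); rewrite repG ?adj_neq //.
    by case/norP.
  move=> K KS cK Kn; have [||x xK xe] := hit K KS; first exact/clique_matching.
    by rewrite sum1_card.
  by exists x => //; rewrite inE xe.
Qed.

(* A clique is contained in the union of the cells over a matching of cell
   representatives, so maximum cliques are exactly such unions over matchings
   of maximum total cell size. *)
Lemma colorable_xnor :
  represents row col (fun a b => ~~ (a (+) b)) -> colorable G (clique_number G).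
Proof.
move=> repG; apply: colorable_of_stable_transversals => S n e eS bound.
pose rep := cell_rep row col S; pose T := rep @: S.
have repP x : x \in S -> [/\ rep x \in S, row (rep x) = row x & col (rep x) = col x].
  exact: cell_repP.
have T_inj x y : x \in T -> y \in T -> row x = row y -> col x = col y -> x = y.
  move=> /imsetP[u uS ->] /imsetP[v vS ->]; exact: cell_rep_inj.
have TS : T \subset S by apply/subsetP => _ /imsetP[x xS ->]; case: (repP x xS).
have repT x : x \in T -> rep x = x.
  move=> xT; have xS := subsetP TS x xT; have [_ rx cx] := repP x xS.
  by apply: T_inj => //; apply: imset_f.
pose w x := #|[set y in S | rep y == x]|.
pose cells (M : {set V}) := [set y in S | rep y \in M].
have w_cells M : \sum_(x in M) w x = #|cells M|.
  rewrite -sum1_card [RHS](partition_big rep [in M]) /=; last first.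
    by move=> y; rewrite inE => /andP[].
  apply: eq_bigr => x xM; rewrite /w -sum1_card; apply: eq_bigl => y.
  rewrite !inE; case: eqP => [->|]; last by rewrite !andbF.
  by rewrite xM !andbT.
have cells_clique M : M \subset T -> matching row col M -> clique G (cells M).
  move=> MT mM; apply/cliqueP => x y; rewrite !inE.
  move=> /andP[xS xM] /andP[yS yM] xy; rewrite repG //.
  have [_ <- <-] := repP x xS; have [_ <- <-] := repP y yS.
  have [E|nE] := eqVneq (rep x) (rep y); first by rewrite E !eqxx.
  have [rE|_] := eqVneq (row _); first by case/eqP: nE; apply: mM => //; left.
  have [cE|_] := eqVneq (col _); first by case/eqP: nE; apply: mM => //; right.
  by [].
have clique_reps K : K \subset S -> clique G K ->
    rep @: K \subset T /\ matching row col (rep @: K).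
  move=> KS /cliqueP cK; split; first exact: imsetS.
  move=> _ _ /imsetP[x xK ->] /imsetP[y yK ->].
  have xS := subsetP KS x xK; have yS := subsetP KS y yK.
  have [_ rx cx] := repP x xS; have [_ ry cy] := repP y yS.
  have [->//|xy] := eqVneq x y; have := cK x y xK yK xy.
  rewrite repG // rx cx ry cy => + sh.
  have [rE|nr] := eqVneq (row x); have [cE|nc] := eqVneq (col x) => //= _.
    exact: eq_cell_rep.
  by case: sh => E; [case/eqP: nr|case/eqP: nc].
(* The cells met by [K] form a clique in [S] containing [K]; as [K] already has the maximal size
   [n], it is their whole union and contains their representatives. *)
have rep_mem K : K \subset S -> clique G K -> #|K| = n ->
    forall x, x \in rep @: K -> x \in K.
  move=> KS cK Kn x xK; have [KT mK] := clique_reps K KS cK.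
  have sub : K \subset cells (rep @: K).
    by apply/subsetP => y yK; rewrite inE (subsetP KS) //= imset_f.
  have xT := subsetP KT x xK.
  have /eqP-> : K == cells (rep @: K).
    rewrite eqEcard sub Kn; apply: bound; last exact: cells_clique.
    by apply/subsetP => y; rewrite inE => /andP[].
  by rewrite inE (subsetP TS) //= repT.
have weight_reps K : K \subset S -> clique G K -> #|K| = n ->
    \sum_(x in rep @: K) w x = n.
  move=> KS cK Kn; have [KT mK] := clique_reps K KS cK.
  rewrite w_cells; apply/eqP; rewrite eqn_leq bound ?cells_clique //; last first.
    by apply/subsetP => y; rewrite inE => /andP[].
  rewrite -{1}Kn subset_leq_card //; apply/subsetP => y yK.
  by rewrite inE (subsetP KS) //= imset_f.
have reT : rep e \in T by apply: imset_f.
have we : 0 < w (rep e) by apply/card_gt0P; exists e; rewrite inE eS /=.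
have [M MT mM|hit|hit] := @max_matchings_meet _ _ _ row col T w n (rep e) reT we.
- rewrite w_cells bound ?cells_clique //.
  by apply/subsetP => y; rewrite inE => /andP[].
(* A full row need not be stable, since vertices of one cell are adjacent. Distinct representatives
   in a row lie in different columns and are non-adjacent. *)
- exists [set x in T | row x == row (rep e)].
    move=> x y; rewrite !inE => /andP[xT /eqP xe] /andP[yT /eqP ye].
    apply/negP => Gxy; have xy := adj_neq Gxy; move: Gxy.
    rewrite repG // xe ye eqxx /= negbK => /eqP cE.
    by case/eqP: xy; apply: T_inj; rewrite ?xe ?ye.
  move=> K KS cK Kn; have [KT mK] := clique_reps K KS cK.
  have [x xK xe] := hit _ KT mK (weight_reps K KS cK Kn).
  by exists x; [apply: rep_mem|rewrite inE (subsetP KT) //= xe].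
- exists [set x in T | col x == col (rep e)].
    move=> x y; rewrite !inE => /andP[xT /eqP xe] /andP[yT /eqP ye].
    apply/negP => Gxy; have xy := adj_neq Gxy; move: Gxy.
    rewrite repG // xe ye eqxx /= addbT negbK => /eqP cE.
    by case/eqP: xy; apply: T_inj; rewrite ?xe ?ye.
  move=> K KS cK Kn; have [KT mK] := clique_reps K KS cK.
  have [x xK xe] := hit _ KT mK (weight_reps K KS cK Kn).
  by exists x; [apply: rep_mem|rewrite inE (subsetP KT) //= xe].
Qed.

End Colorings.

(** * Reduction of the sixteen functions, and perfection *)

Lemma represents_colorable (V : finType) (G : sgraph V) (R C : eqType)
    (row : V -> R) (col : V -> C) f :
  represents G row col f -> colorable G (clique_number G).
Proof.
move=> repG; pose cell x := (row x, col x).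
case f11: (f true true); case f10: (f true false);
case f01: (f false true); case f00: (f false false).
all: have red : forall x y, x != y -> G x y = if row x == row y
  then if col x == col y then f true true else f true false
  else if col x == col y then f false true else f false false
  by move=> x y xy; rewrite repG //; do 2!case: (_ == _).
all: rewrite f11 f10 f01 f00 in red.
(* On distinct vertices, equality of [id] labels is false and equality of [cell] labels is the
   conjunction of the two original equalities. The tactic [t] checks the truth table of each
   candidate relabelling. *)
all: let t := solve [move=> x y xy; rewrite red // /cell ?xpair_eqE ?(negPf xy);
  do 2!case: (_ == _); reflexivity] in
  first
  [ by apply: (@colorable_or _ _ _ _ row col); t
  | by apply: (@colorable_nor _ _ _ _ row col); t
  | by apply: (@colorable_xor _ _ _ _ row col); t
  | by apply: (@colorable_xnor _ _ _ _ row col); t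
  | by apply: (@colorable_or _ _ _ _ id id); t
  | by apply: (@colorable_nor _ _ _ _ id id); t
  | by apply: (@colorable_or _ _ _ _ row id); t
  | by apply: (@colorable_nor _ _ _ _ row id); t
  | by apply: (@colorable_or _ _ _ _ id col); t
  | by apply: (@colorable_nor _ _ _ _ id col); t
  | by apply: (@colorable_or _ _ _ _ cell id); t
  | by apply: (@colorable_nor _ _ _ _ cell id); t
  | by apply: (@colorable_xor _ _ _ _ row cell); t
  | by apply: (@colorable_xnor _ _ _ _ row cell); t
  | by apply: (@colorable_xor _ _ _ _ cell col); t
  | by apply: (@colorable_xnor _ _ _ _ cell col); t ].
Qed.

(** The canonical root of the component serves as the label of a vertex. *)
Lemma equivalence_graph_root (V : finType) (H : sgraph V) x y :
  equivalence_graph H -> x != y -> H x y = (root H x == root H y).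
Proof.
move=> eqH xy; have symH : connect_sym H by apply: sym_connect_sym (adj_sym H).
rewrite root_connect //; apply/idP/idP => [/connect1//|xHy].
by move/cliqueP: (eqH x); apply; rewrite ?inE ?connect0.
Qed.

Theorem theorem5p28 (f : bool -> bool -> bool) (V : finType) (G : sgraph V) :
  bool_class f equivalence_graph G -> perfect G.
Proof.
move=> [H1 [H2 [eqH1 eqH2 GE]]] S; apply: chromatic_eq_clique_number.
(* Composing with [val] restricts both labellings to [S], so the induced subgraph is represented by
   the same [f]. *)
apply: (@represents_colorable _ _ _ _ (root H1 \o val) (root H2 \o val) f).
by move=> x y xy; rewrite /= /induced_rel GE // -!equivalence_graph_root.
Qed.
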